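(* Let $V_1,V_2,V_3$ be finite-dimensional complex vector spaces with $n_i=\dim V_i$, $n_1=2$ and $n_2\le n_3$. Let $T\in V_1\otimes V_2\otimes V_3$ be a concise tensor and let $k$ be an integer with $1\le k\le n_2$, where moreover $k<n_2$ if $n_2=n_3$. Suppose that the $k$-th base locus scheme $B^1_k(T)$ is $0$-dimensional (possibly empty), and let $p=\deg(B^1_k(T))$ (so $p=0$ if $B^1_k(T)=\emptyset$). If $p<k$, then the collineation variety $\mathscr{C}^1_k(T)$ is the rational normal curve of degree $k-p$ (in its linear span); if $p=k$, then $\mathscr{C}^1_k(T)$ is a point.
   Context: A tensor $T\in V_1\otimes V_2\otimes V_3$ is concise if its three flattening maps $V_1^*\to V_2\otimes V_3$, $V_2^*\to V_1\otimes V_3$, $V_3^*\to V_1\otimes V_2$ (given by contraction) are injective. Choosing bases, the image $T(V_1^* )\subseteq V_2\otimes V_3$ of the first flattening is regarded as an $n_2\times n_3$ matrix whose entries are linear forms on $V_1^*$. The $k$-th collineation variety $\mathscr{C}^1_k(T)\subseteq\mathbb{P}(\Lambda^kV_2\otimes\Lambda^kV_3)$ is the Zariski closure of the image of the rational map $\mathbb{P}(V_1^* )\dashrightarrow\mathbb{P}(\Lambda^kV_2\otimes\Lambda^kV_3)$ whose coordinates are the $k\times k$ minors of this matrix; it is defined when these minors are not all identically zero. The $k$-th base locus scheme is $B^1_k(T)=\mathbb{P}(T(V_1^* ))\cap\sigma_{k-1}$, where $\sigma_{k-1}\subseteq\mathbb{P}(V_2\otimes V_3)$ is the determinantal variety of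 matrices of rank at most $k-1$. Equivalently, it is the subscheme of $\mathbb{P}(V_1^* )$ defined by the $k\times k$ minors of the matrix of linear forms. *)

(* Defs.v *)
From HB Require Import structures.
From mathcomp Require Import all_boot all_order all_algebra.
From mathcomp Require Import classical_sets reals complex.
From mathcomp Require Import mpoly.

Set Implicit Arguments.
Unset Strict Implicit.
Unset Printing Implicit Defensive.

Import Order.TTheory GRing.Theory Num.Theory.
Local Open Scope classical_set_scope.
Local Open Scope ring_scope.

(* [T i j l] is the coefficient of e_i (x) e_j (x) e_l in V1 (x) V2 (x) V3 with
   V_a = F^(n_a); elements of V_a^* are row vectors in the dual basis. *)
Definition tensor (F : fieldType) (n1 n2 n3 : nat) : Type :=
  'I_n1 -> 'I_n2 -> 'I_n3 -> F.

Section Flattenings.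
Variables (F : fieldType) (n1 n2 n3 : nat) (T : tensor F n1 n2 n3).

Definition flattening1 (x : 'rV[F]_n1) : 'M[F]_(n2, n3) :=
  \matrix_(j, l) \sum_i x 0 i * T i j l.
Definition flattening2 (y : 'rV[F]_n2) : 'M[F]_(n1, n3) :=
  \matrix_(i, l) \sum_j y 0 j * T i j l.
Definition flattening3 (z : 'rV[F]_n3) : 'M[F]_(n1, n2) :=
  \matrix_(i, j) \sum_l z 0 l * T i j l.

Definition concise : Prop :=
  [/\ injective flattening1, injective flattening2 & injective flattening3].

(* The entries are linear forms on V1^*; evaluating them at [x] gives
   [flattening1 x]. *)
Definition linear_form_mx : 'M[{mpoly F[n1]}]_(n2, n3) :=
  \matrix_(j, l) \sum_i T i j l *: 'X_i.

End Flattenings.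

(* The k-element subsets of 'I_n, listed increasingly: they index the standard
   basis of the k-th exterior power of F^n. *)
Definition ksubset (n k : nat) : finType :=
  {t : k.-tuple 'I_n | sorted ltn [seq val i | i <- t]}.

(* The index of a k x k minor, equivalently of a standard basis vector of
   L^k(F^n2) (x) L^k(F^n3), whose dimension is [nminors n2 n3 k]. *)
Definition minor_index (n2 n3 k : nat) : finType :=
  (ksubset n2 k * ksubset n3 k)%type.

Definition nminors (n2 n3 k : nat) : nat := #|{: minor_index n2 n3 k}|.

Definition minor (A : comNzRingType) (n2 n3 k : nat) (M : 'M[A]_(n2, n3))
    (rc : minor_index n2 n3 k) : A :=
  \det (mxsub (tnth (val rc.1)) (tnth (val rc.2)) M).

Definition tensor_minors (F : fieldType) (n1 n2 n3 : nat)
    (T : tensor F n1 n2 n3) (k : nat) (a : 'I_(nminors n2 n3 k)) :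
    {mpoly F[n1]} :=
  minor (linear_form_mx T) (enum_val a).

(* A point of P(F^n) is a nonzero row vector up to scaling.  A subset of P(F^n)
   is the set of all the vectors representing its points. *)
Section Projective.
Variables (F : fieldType) (n : nat).

Definition homogeneous (f : {mpoly F[n]}) : Prop := exists d, f \is d.-homog.

Definition zero_locus (I : set {mpoly F[n]}) : set 'rV[F]_n :=
  [set x : 'rV[F]_n | x <> 0 /\ forall f, I f -> f.@[x 0] = 0].

Definition zariski_closure (X : set 'rV[F]_n) : set 'rV[F]_n :=
  zero_locus [set f | homogeneous f /\ forall x, X x -> f.@[x 0] = 0].

Definition zariski_closed (Z : set 'rV[F]_n) : Prop := zariski_closure Z = Z.

Definition irreducible_closed (Z : set 'rV[F]_n) : Prop :=
  [/\ zariski_closed Z, Z !=set0 &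
      forall A B, zariski_closed A -> zariski_closed B ->
        Z `<=` A `|` B -> Z `<=` A \/ Z `<=` B].

(* There is no strict inclusion of irreducible closed subsets of [X], that is
   [X] has topological (Krull) dimension 0 or is empty. *)
Definition dim_le0 (X : set 'rV[F]_n) : Prop :=
  forall Z0 Z1, irreducible_closed Z0 -> irreducible_closed Z1 ->
    Z0 `<=` Z1 -> Z1 `<=` X -> Z0 = Z1.

Definition ideal_generated (N : nat) (g : 'I_N -> {mpoly F[n]}) :
    set {mpoly F[n]} :=
  [set f | exists h : 'I_N -> {mpoly F[n]}, f = \sum_a h a * g a].

Definition is_projective_point (X : set 'rV[F]_n) : Prop :=
  exists2 v : 'rV[F]_n, v <> 0 &
    X = [set y | exists2 c : F, c <> 0 & y = c *: v].

Definition veronese (m : nat) (x : 'rV[F]_2) : 'rV[F]_m.+1 :=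
  \row_(a < m.+1) (x 0 0 ^+ (m - a) * x 0 1 ^+ a).

(* The row space of [M] is the linear span of the curve; [row_free M] makes [M]
   an isomorphism from P^m onto it. *)
Definition is_rational_normal_curve (m : nat) (X : set 'rV[F]_n) : Prop :=
  exists2 M : 'M[F]_(m.+1, n), row_free M &
    X = [set y | exists x : 'rV[F]_2, exists c : F,
                   [/\ x <> 0, c <> 0 & y = c *: (veronese m x *m M)]].

End Projective.

Section Degree.
Variables (F : fieldType) (n : nat).

(* [h = dim_F (S/I)_d] for a homogeneous ideal [I] of S = F[X_0, .., X_n]; the
   space [U] is the degree d piece of [I]. *)
Definition hilbert_function (I : set {mpoly F[n.+1]}) (d h : nat) : Prop :=
  exists2 U : {vspace (dhomog n.+1 F d)},
    (forall f : dhomog n.+1 F d, f \in U <-> I (mpoly_of_dhomog f)) &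
    h = (\dim (fullv : {vspace (dhomog n.+1 F d)}) - \dim U)%N.

Definition is_hilbert_polynomial (I : set {mpoly F[n.+1]}) (P : {poly rat}) :
    Prop :=
  exists d0 : nat, forall d : nat, (d0 <= d)%N ->
    exists2 h : nat, hilbert_function I d h & P.[d%:R] = h%:R.

(* The degree of Proj(S/I) is r! times the leading coefficient of its Hilbert
   polynomial, r being the degree of that polynomial; it is 0 when Proj(S/I) is
   empty. *)
Definition proj_degree (I : set {mpoly F[n.+1]}) (p : nat) : Prop :=
  exists2 P : {poly rat}, is_hilbert_polynomial I P &
    lead_coef P * ((size P).-1)`!%:R = p%:R.

End Degree.

Section Collineation.
Variables (F : fieldType) (n1 n2 n3 : nat) (T : tensor F n1 n2 n3) (k : nat).

Definition collineation_map (x : 'rV[F]_n1) : 'rV[F]_(nminors n2 n3 k) :=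
  \row_a (tensor_minors T a).@[x 0].

(* The rational map is defined where the minors do not all vanish. *)
Definition collineation_variety : set 'rV[F]_(nminors n2 n3 k) :=
  zariski_closure
    [set y | y <> 0 /\ exists x : 'rV[F]_n1, y = collineation_map x].

(* The base locus scheme is Proj of the quotient by this ideal. *)
Definition base_locus_ideal : set {mpoly F[n1]} :=
  ideal_generated (@tensor_minors F n1 n2 n3 T k).

End Collineation.

Arguments collineation_variety {F n1 n2 n3} T k.

(* Main.v *)
Require Import Defs.
From HB Require Import structures.
From mathcomp Require Import all_boot all_order all_algebra all_fingroup.
From mathcomp Require Import classical_sets reals complex.
From mathcomp Require Import mpoly.
From mathcomp Require Import boolp ring.

(** The k x k minors of a pencil M span D S_(k-d), where S_j denotes the binary
    forms of degree j and D is the gcd of the minors, of degree d.  By induction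
    on the size: over an algebraically closed field, and up to transposition,
    there are a row vector u <> 0, a linear form l <> 0 and a constant row vector
    w with u M = l w.  If w = 0, a row can be dropped.  Otherwise M is equivalent
    to the block matrix [[l, 0], [c, N]], and Laplace expansion puts the span of
    the k-minors of M between l V and S_1 V, where V = D' S_j is the span of the
    (k-1)-minors of N.  Since l S_j is a hyperplane of S_(j+1), the span is either
    (l D') S_j or D' S_(j+1).

    Hence the base locus ideal agrees with (D) in degrees >= k, so d = p, and,
    away from the zeros of D, the collineation map is the Veronese map of degree
    k - p followed by an injective linear map. *)

Set Implicit Arguments.
Unset Strict Implicit.
Unset Printing Implicit Defensive.

Import Order.TTheory GRing.Theory Num.Theory.
Local Open Scope ring_scope.

(** * Pencils and their minors *)

Section Pencil.
Variable F : fieldType.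

(** The matrix x0 A + x1 B of linear forms, dehomogenized at x0 = 1, x1 = X. *)
Definition pencil n m (A B : 'M[F]_(n, m)) : 'M[{poly F}]_(n, m) :=
  map_mx polyC A + 'X *: map_mx polyC B.

(** Arbitrary constant [P] and [Q], instead of row and column selections, make the span of the
    minors visibly invariant under equivalence of pencils. *)
Definition gen_minor n m k (A B : 'M[F]_(n, m)) (P : 'M_(k, n)) (Q : 'M_(m, k)) :=
  \det (pencil (P *m A *m Q) (P *m B *m Q)).

(* The linear span, as the intersection of the subspaces containing the minors. *)
Definition minor_span n m k (A B : 'M[F]_(n, m)) (f : {poly F}) : Prop :=
  forall W : {poly F} -> Prop, W 0 ->
    (forall c u v, W u -> W v -> W (c *: u + v)) ->
    (forall (P : 'M_(k, n)) (Q : 'M_(m, k)), W (gen_minor A B P Q)) -> W f.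

Lemma pencilE n m (A B : 'M[F]_(n, m)) i j :
  pencil A B i j = (A i j)%:P + 'X * (B i j)%:P.
Proof. by rewrite !mxE. Qed.

Lemma pencil0 n m : pencil (0 : 'M[F]_(n, m)) 0 = 0.
Proof. by apply/matrixP=> i j; rewrite pencilE !mxE mulr0 addr0. Qed.

Lemma tr_pencil n m (A B : 'M[F]_(n, m)) : (pencil A B)^T = pencil A^T B^T.
Proof. by apply/matrixP=> i j; rewrite mxE !pencilE !mxE. Qed.

Lemma size_pencil n m (A B : 'M[F]_(n, m)) i j : (size (pencil A B i j) <= 2)%N.
Proof.
rewrite pencilE (leq_trans (size_polyD _ _)) // geq_max.
rewrite (leq_trans (size_polyC_leq1 _)) //=.
by rewrite mulrC (leq_trans (size_polyMleq _ _)) // size_polyX addn2 /= ltnS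
   size_polyC_leq1.
Qed.

Lemma minor_span0 n m k (A B : 'M[F]_(n, m)) : minor_span k A B 0.
Proof. by []. Qed.

Lemma minor_span_gen n m k (A B : 'M[F]_(n, m)) (P : 'M_(k, n)) Q :
  minor_span k A B (gen_minor A B P Q).
Proof. by move=> W _ _; apply. Qed.

Lemma minor_spanP n m k (A B : 'M[F]_(n, m)) c u v :
  minor_span k A B u -> minor_span k A B v -> minor_span k A B (c *: u + v).
Proof.
move=> Hu Hv W W0 Wl Wg.
by apply: (Wl); [exact: (Hu W W0 Wl Wg) | exact: (Hv W W0 Wl Wg)].
Qed.

Lemma minor_spanZ n m k (A B : 'M[F]_(n, m)) c u :
  minor_span k A B u -> minor_span k A B (c *: u).
Proof. by move=> Hu; rewrite -[_ *: _]addr0; apply: minor_spanP. Qed.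

Lemma minor_span_mul n m n' m' k (A B : 'M[F]_(n, m)) (P : 'M_(n', n))
    (Q : 'M_(m, m')) f :
  minor_span k (P *m A *m Q) (P *m B *m Q) f -> minor_span k A B f.
Proof.
move/(_ (minor_span k A B)); apply=> [|c u v|P' Q'].
- exact: minor_span0.
- exact: minor_spanP.
have := @minor_span_gen _ _ k A B (P' *m P) (Q *m Q').
by rewrite /gen_minor !mulmxA.
Qed.

Lemma minor_span_tr n m k (A B : 'M[F]_(n, m)) f :
  minor_span k A B f -> minor_span k A^T B^T f.
Proof.
move/(_ (minor_span k A^T B^T)); apply=> [|c u v|P Q].
- exact: minor_span0.
- exact: minor_spanP.
have := @minor_span_gen _ _ k A^T B^T Q^T P^T.
by rewrite /gen_minor -!trmx_mul -tr_pencil det_tr !mulmxA.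
Qed.

(** For u nonzero, the rank factorization writes u as s (1, 0, .., 0) times an invertible matrix,
    with a scalar s nonzero; [R] undoes both factors. *)
Lemma row_normal_form n (u : 'rV[F]_(1 + n)) :
  exists2 R : 'M_(1 + n), R \in unitmx & u *m R = row_mx (u != 0)%:R%:M 0.
Proof.
have [->|u0] := eqVneq u 0.
  by exists 1%:M; rewrite ?unitmx1 // mul0mx /= raddf0 row_mx0.
have ur : \rank u = 1%N by apply/eqP; rewrite eqn_leq rank_leq_row lt0n mxrank_eq0.
pose s := col_ebase u 0 0.
have s0 : s != 0.
  by have := col_ebase_unit u; rewrite unitmxE det_mx11 unitfE.
exists (s^-1 *: invmx (row_ebase u)).
  by rewrite unitmxZ ?unitmx_inv ?row_ebase_unit // unitfE invr_eq0.
have := mulmx_ebase u; rewrite ur => eu; rewrite -scalemxAr -[X in X *m _]eu.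
rewrite mulmxK ?row_ebase_unit // [col_ebase u]mx11_scalar -/s.
rewrite mul_scalar_mx scalerA mulVf // scale1r.
rewrite -[pid_mx 1]hsubmxK; congr row_mx; apply/matrixP => i j.
  by rewrite !mxE !ord1.
by rewrite !mxE !ord1.
Qed.

Lemma row_completion n (u : 'rV[F]_(1 + n)) : u != 0 ->
  exists2 P : 'M_(1 + n), P \in unitmx & usubmx P = u.
Proof.
move=> u0; have [R uR eR] := row_normal_form u.
exists (invmx R); first by rewrite unitmx_inv.
rewrite -[RHS](mulmxK uR) eR u0 -[in RHS](vsubmxK (invmx R)).
by rewrite mul_row_col mul0mx addr0 mul_scalar_mx scale1r.
Qed.

Lemma row'_mulmx n m p (i : 'I_n.+1) (A : 'M[F]_(n.+1, m)) (B : 'M_(m, p)) :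
  row' i (A *m B) = row' i A *m B.
Proof. by apply/matrixP=> a b; rewrite !mxE; apply: eq_bigr => c _; rewrite mxE. Qed.

Lemma col'_mulmx n m p (i : 'I_p.+1) (A : 'M[F]_(n, m)) (B : 'M_(m, p.+1)) :
  col' i (A *m B) = A *m col' i B.
Proof. by apply/matrixP=> a b; rewrite !mxE; apply: eq_bigr => c _; rewrite mxE. Qed.

(* Laplace expansion along a column, after column operations that make the
   first row of [Q] proportional to (1, 0, .., 0). *)
Lemma gen_minor_laplace n m k (a b : F) (c c' : 'cV_n) (A B : 'M[F]_(n, m))
    (P : 'M_(k.+1, 1 + n)) (Q : 'M_(1 + m, k.+1)) (W : {poly F} -> Prop) :
  W 0 -> (forall u v, W u -> W v -> W (u + v)) ->
  (forall (l : {poly F}) (P' : 'M_(k, n)) (Q' : 'M_(m, k)), (size l <= 2)%N ->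
     W (l * gen_minor A B P' Q')) ->
  W (gen_minor (block_mx a%:M 0 c A) (block_mx b%:M 0 c' B) P Q).
Proof.
move=> W0 WD WM.
set A1 := block_mx _ _ _ A; set B1 := block_mx _ _ _ B.
have [R uR eR] := @row_normal_form k (usubmx Q).
set M := pencil (P *m A1 *m (Q *m R)) (P *m B1 *m (Q *m R)).
have detM : gen_minor A1 B1 P Q = (\det R)^-1 *: \det M.
  have -> : M = pencil (P *m A1 *m Q) (P *m B1 *m Q) *m map_mx polyC R.
    by rewrite /M /pencil mulmxDl -scalemxAl -!map_mxM !mulmxA.
  rewrite det_mulmx det_map_mx /= -[gen_minor _ _ _ _]/(\det _) mulrC.
  by rewrite mul_polyC scalerA mulVf ?scale1r // -unitfE -unitmxE.
rewrite detM (expand_det_col M ord0) scaler_sumr.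
apply: (big_ind W) => // i _.
rewrite /cofactor scalerAl mulrA.
(* Without its first column, [Q *m R] has first row zero. The cofactors therefore see only the lower
   right blocks. *)
have Q0 : usubmx (col' ord0 (Q *m R) : 'M_(1 + m, k)) = 0.
  apply/matrixP=> x y; rewrite [RHS]mxE.
  have := congr1 (fun Z : 'rV_(1 + k) => Z 0 (rshift 1 y)) eR.
  rewrite row_mxEr [X in _ = X]mxE mxE => eR0; rewrite -[RHS]eR0 ord1 !mxE.
  apply: eq_bigr => z _; rewrite !mxE; congr (_ * R _ _); exact/val_inj.
have eqM Y Y1 cY y : Y1 = block_mx y%:M 0 cY Y ->
  row' i (col' ord0 (P *m Y1 *m (Q *m R))) =
  rsubmx (row' i P : 'M_(k, 1 + n)) *m Y *m dsubmx (col' ord0 (Q *m R) : 'M_(1 + m, k)).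
  move=> ->; rewrite col'_mulmx !row'_mulmx.
  rewrite -[row' i P](hsubmxK (row' i P : 'M_(k, 1 + n))).
  rewrite -[col' ord0 (Q *m R)](vsubmxK (col' ord0 (Q *m R) : 'M_(1 + m, k))) Q0.
  rewrite mul_row_block mul_row_col !mulmx0 !add0r.
  by rewrite row_mxKr col_mxKd.
have -> : row' i (col' ord0 M) = pencil (row' i (col' ord0 (P *m A1 *m (Q *m R))))
    (row' i (col' ord0 (P *m B1 *m (Q *m R)))).
  by apply/matrixP=> x y; rewrite !(mxE, pencilE).
rewrite (eqM A A1 c a) // (eqM B B1 c' b) //; apply: WM.
rewrite mulrC.
have -> : (-1 : {poly F}) ^+ (i + 0) = ((-1) ^+ (i + 0))%:P.
  by rewrite rmorphXn rmorphN1.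
rewrite mul_polyC (leq_trans (size_scale_leq _ _)) //.
by rewrite (leq_trans (size_scale_leq _ _)) // size_pencil.
Qed.

(** Bordering [P] and [Q] by a 1 makes the compressed pencil block triangular, with the linear form
    in the corner. *)
Lemma gen_minor_block n m k (a b : F) (c c' : 'cV_n) (A B : 'M[F]_(n, m))
    (P : 'M_(k, n)) (Q : 'M_(m, k)) :
  (a%:P + 'X * b%:P) * gen_minor A B P Q =
  gen_minor (block_mx a%:M 0 c A) (block_mx b%:M 0 c' B)
    (block_mx 1%:M 0 0 P : 'M_(1 + k, 1 + n)) (block_mx 1%:M 0 0 Q).
Proof.
rewrite /gen_minor !mulmx_block !(mul0mx, mulmx0, add0r, addr0, mul1mx, mulmx1).
set c1 := _ *m c; set c2 := _ *m c'.
have -> (A' B' : 'M[F]_k) : pencil (block_mx a%:M 0 c1 A') (block_mx b%:M 0 c2 B')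
   = block_mx (a%:P + 'X * b%:P)%:M 0 (pencil c1 c2) (pencil A' B').
  rewrite /pencil !map_block_mx scale_block_mx add_block_mx !map_mx0 scaler0 addr0.
  congr block_mx; rewrite !map_scalar_mx /= scale_scalar_mx.
  by rewrite -raddfD.
by rewrite det_lblock det_scalar1.
Qed.

(* A binary form of degree [j] is represented by a polynomial of size at most
   [j + 1]; the root of the linear form [l] is the point at infinity when [l] is
   a constant polynomial. *)
Lemma linear_form_root (l : {poly F}) (j : nat) : l != 0 -> (size l <= 2)%N ->
  exists2 phi : {poly F} -> F, (forall c u v, phi (c *: u + v) = c * phi u + phi v) &
    forall r : {poly F}, (size r <= j.+2)%N -> phi r = 0 ->
      exists2 q : {poly F}, (size q <= j.+1)%N & r = l * q.
Proof.
move=> l0; rewrite leq_eqVlt => /orP[/eqP s2|s1].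
  have [x lx] := poly2_root s2.
  exists (fun r => r.[x]) => [c u v|r sr /eqP rx]; first by rewrite !hornerE.
  have [[c lE] [q rE]] := (factor_theorem _ _ lx, factor_theorem r x rx).
  have c0 : c != 0 by apply: contraNneq l0 => c0; rewrite lE c0 mul0r.
  have sc : size c = 1.
    by move: s2; rewrite lE size_Mmonic ?monicXsubC // size_XsubC addn2 /= => -[].
  have [a a0 cE] : exists2 a, a != 0 & c = a%:P by apply/size_poly1P; rewrite sc.
  exists (a^-1 *: q).
    rewrite (leq_trans (size_scale_leq _ _)) //.
    have [->|q0] := eqVneq q 0; first by rewrite size_poly0.
    by move: sr; rewrite rE size_Mmonic ?monicXsubC // size_XsubC addn2.
  by rewrite lE cE rE -scalerAr mulrAC mul_polyC -scalerAl scalerA mulVf // scale1r mulrC.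
have [a a0 ->] : exists2 a, a != 0 & l = a%:P.
  by apply/size_poly1P; rewrite eqn_leq -ltnS s1 lt0n size_poly_eq0.
exists (fun r => r`_j.+1) => [c u v|r sr r0]; first by rewrite coefD coefZ.
exists (a^-1 *: r); last by rewrite mul_polyC scalerA mulfV // scale1r.
rewrite (leq_trans (size_scale_leq _ _)) //; apply/leq_sizeP => i.
rewrite leq_eqVlt => /orP[/eqP <- //|]; move/leq_sizeP: sr; exact.
Qed.
End Pencil.

(** * Spans consisting of the multiples of a binary form *)

Section SpansForm.
Variable F : fieldType.

(** The space D S_(k-d). The degree [d] of the form is recorded separately, since it exceeds that of
    the polynomial [D] when the form vanishes at infinity. *)
Definition multiples_of_form k (D : {poly F}) d f : Prop :=
  exists2 q : {poly F}, (size q <= (k - d).+1)%N & f = D * q.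

Definition spans_multiples n m k (A B : 'M[F]_(n, m)) : Prop :=
  (forall f, minor_span k A B f -> f = 0) \/
  exists (D : {poly F}) d, [/\ D != 0, (size D <= d.+1)%N, (d <= k)%N &
    forall f, minor_span k A B f <-> multiples_of_form k D d f].

Lemma multiples_of_form0 k D d : multiples_of_form k D d 0.
Proof. by exists 0; rewrite ?size_poly0 ?mulr0. Qed.

Lemma multiples_of_formP k D d c u v :
  multiples_of_form k D d u -> multiples_of_form k D d v ->
  multiples_of_form k D d (c *: u + v).
Proof.
move=> [q sq ->] [r sr ->]; exists (c *: q + r); last by rewrite mulrDr scalerAr.
rewrite (leq_trans (size_polyD _ _)) // geq_max sr andbT.
by rewrite (leq_trans (size_scale_leq _ _)).
Qed.

Lemma eq_spans_multiples n m n' m' k (A B : 'M[F]_(n, m)) (A' B' : 'M_(n', m')) :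
  (forall f, minor_span k A B f <-> minor_span k A' B' f) ->
  spans_multiples k A' B' -> spans_multiples k A B.
Proof.
move=> eqAB [H0|[D [d [D0 sD ld HD]]]]; first by left=> f /eqAB/H0.
by right; exists D, d; split=> // f; rewrite eqAB.
Qed.

(** Factorizations in both directions suffice, without invertible matrices; this also covers the
    removal of a zero row. *)
Lemma spans_multiples_mul n m n' m' k (A B : 'M[F]_(n, m)) (A' B' : 'M_(n', m'))
    X X' Y Y' :
  A' = X *m A *m Y -> B' = X *m B *m Y -> A = X' *m A' *m Y' -> B = X' *m B' *m Y' ->
  spans_multiples k A' B' -> spans_multiples k A B.
Proof.
move=> eA' eB' eA eB; apply: eq_spans_multiples => f.
split; first by rewrite eA eB; apply: minor_span_mul.
by rewrite eA' eB'; apply: minor_span_mul.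
Qed.

Lemma spans_multiples_tr n m k (A B : 'M[F]_(n, m)) :
  spans_multiples k A^T B^T -> spans_multiples k A B.
Proof.
apply: eq_spans_multiples => f.
by split=> /minor_span_tr //; rewrite !trmxK.
Qed.

Lemma spans_multiples_col n m k (A B : 'M[F]_(n, m)) :
  spans_multiples k A B ->
  spans_multiples k (col_mx 0 A : 'M_(1 + n, m)) (col_mx 0 B).
Proof.
apply: (@spans_multiples_mul _ _ _ _ _ _ _ _ _ (row_mx 0 1%:M) (col_mx 0 1%:M) 1%:M 1%:M);
by rewrite mulmx1 ?mul_row_col ?mul_col_mx !mul0mx ?mul1mx ?add0r.
Qed.

Lemma spans_multiples0 n m (A B : 'M[F]_(n, m)) : spans_multiples 0 A B.
Proof.
right; exists 1, 0; split; rewrite ?oner_eq0 ?size_poly1 // => f; split.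
  move/(_ (multiples_of_form 0 1 0)); apply=> [|c u v|P Q].
  - exact: multiples_of_form0.
  - exact: multiples_of_formP.
  - by exists 1; rewrite ?size_poly1 // /gen_minor det_mx00 mulr1.
case=> q /size1_polyC -> ->; rewrite mul1r -[_%:P]mulr1 mul_polyC.
apply: minor_spanZ; have := @minor_span_gen _ _ _ 0 A B 0 0.
by rewrite /gen_minor det_mx00.
Qed.

Lemma spans_multiples_flat m k (A B : 'M[F]_(0, m)) : spans_multiples k.+1 A B.
Proof.
left=> f /(_ (fun f => f = 0)); apply=> // [c u v -> ->|P Q]; first by rewrite scaler0 add0r.
by rewrite /gen_minor [A]flatmx0 [B]flatmx0 !mulmx0 !mul0mx pencil0 det0.
Qed.

(* The minors of size [k + 1] of the block pencil lie between [l V] and [S_1 V],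
   where [V = D S_(k-d)] is spanned by the minors of size [k] of the lower
   right block. As [l S_(k-d)] is a hyperplane of [S_(k-d+1)], they span either
   [l D S_(k-d)] or [D S_(k-d+1)]. *)
Lemma spans_multiples_block n m k (a b : F) (c c' : 'cV_n) (A B : 'M[F]_(n, m)) :
  a%:P + 'X * b%:P != 0 -> spans_multiples k A B ->
  spans_multiples k.+1 (block_mx a%:M 0 c A) (block_mx b%:M 0 c' B).
Proof.
set l := _ + _ => l0.
have sl : (size l <= 2)%N.
  have := @size_pencil F 1 1 a%:M b%:M 0 0.
  by rewrite pencilE !mxE.
set A1 := block_mx _ _ _ A; set B1 := block_mx _ _ _ B.
have lspan f : minor_span k A B f -> minor_span k.+1 A1 B1 (l * f).
  move/(_ (fun f => minor_span k.+1 A1 B1 (l * f))); apply=> [|e u v|P Q].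
  - by rewrite mulr0; apply: minor_span0.
  - by rewrite mulrDr -scalerAr; apply: minor_spanP.
  - by rewrite (gen_minor_block a b c c'); apply: minor_span_gen.
case=> [H0|[D [d [D0 sD ld HD]]]].
  left=> f /(_ (fun f => f = 0)); apply=> // [e u v -> ->|P Q].
    by rewrite scaler0 add0r.
  apply: (@gen_minor_laplace _ _ _ _ _ _ _ _ _ _ _ _ (fun f => f = 0)) => //.
    by move=> u v -> ->; rewrite add0r.
  move=> e P' Q' _.
  by rewrite (H0 _ (minor_span_gen (A := A) (B := B) P' Q')) mulr0.
have upper f : minor_span k.+1 A1 B1 f -> multiples_of_form k.+1 D d f.
  move/(_ (multiples_of_form k.+1 D d)); apply=> [|e u v|P Q].
  - exact: multiples_of_form0.
  - exact: multiples_of_formP.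
  apply: (@gen_minor_laplace _ _ _ _ _ _ _ _ _ _ _ _ (multiples_of_form k.+1 D d))
    => [|u v|e P' Q' se].
  - exact: multiples_of_form0.
  - by move=> Hu Hv; rewrite -[u]scale1r; apply: multiples_of_formP.
  have [q sq ->] := (HD _).1 (minor_span_gen (A := A) (B := B) P' Q').
  exists (e * q); last by rewrite mulrCA.
  rewrite (leq_trans (size_polyMleq _ _)) // subSn //.
  by move: (leq_add se sq); case: (_ + _)%N.
have [phi phiP phi_root] := linear_form_root (k - d) l0 sl.
have phi0 : phi 0 = 0 by have := phiP (-1) 0 0; rewrite scaler0 addr0 mulN1r addNr.
have lower (q : {poly F}) : (size q <= (k - d).+1)%N -> minor_span k.+1 A1 B1 (D * (l * q)).
  by move=> sq; rewrite mulrCA; apply: lspan; apply/HD; exists q.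
(* Forms of degree k - d + 1 killed by [phi] are divisible by l. If some D q0 in the span has
   [phi q0] nonzero, the span is all of D S_(k-d+1); otherwise every element of the span is a
   multiple of l D. *)
have [[q0 [sq0 phiq0 spanq0]]|noq] :=
  EM (exists q0 : {poly F}, [/\ (size q0 <= (k - d).+2)%N, phi q0 != 0 &
    minor_span k.+1 A1 B1 (D * q0)]);
  right; last first.
  exists (l * D), d.+1; split.
  - by rewrite mulf_neq0.
  - rewrite (leq_trans (size_polyMleq _ _)) //.
    by move: (leq_add sl sD); case: (_ + _)%N.
  - by [].
  move=> f; split=> [fspan|[q sq ->]]; last by rewrite mulrAC mulrC; apply: lower.
  have [q + fE] := upper f fspan; rewrite subSn // => sq.
  have [|r sr qE] := phi_root q sq; last by exists r => //; rewrite fE qE mulrCA mulrA.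
  by apply/eqP/negPn/negP=> phiq; apply: noq; exists q; rewrite -fE.
exists D, d; split=> //; first exact: leqW.
move=> f; split; first exact: upper.
case=> q; rewrite subSn // => sq ->.
(* The multiple of [q0] is chosen so that [phi r = 0]; then l divides [r] and [lower] applies. *)
pose r := - (phi q / phi q0) *: q0 + q.
have [||s ss rE] := phi_root r.
- rewrite (leq_trans (size_polyD _ _)) // geq_max sq andbT.
  by rewrite (leq_trans (size_scale_leq _ _)).
- by rewrite phiP mulNr divfK // addNr.
have -> : q = (phi q / phi q0) *: q0 + r by rewrite addrA -scalerDl addrN scale0r add0r.
rewrite mulrDr -scalerAr; apply: minor_spanP => //.
by rewrite rE; apply: lower.
Qed.

End SpansForm.

(** * Pencils over an algebraically closed field *)

Section ClosedField.
Variable F : closedFieldType.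

(** A left null vector of [A] gives the linear form X. Otherwise [A] is square and invertible, and
    an eigenvector of B A^-1 with eigenvalue b gives 1 + b X. *)
Lemma pencil_kernel n m (A B : 'M[F]_(n.+1, m)) : (m <= n.+1)%N ->
  exists (u : 'rV_n.+1) (w : 'rV_m) (a b : F),
    [/\ u != 0, a%:P + 'X * b%:P != 0, u *m A = a *: w & u *m B = b *: w].
Proof.
move=> le_mn; have [fA|nfA] := boolP (row_free A); last first.
  have [u uK u0] : exists2 u : 'rV_n.+1, (u <= kermx A)%MS & u != 0.
    by apply/rowV0Pn; rewrite kermx_eq0.
  exists u, (u *m B), 0, 1; rewrite scale0r scale1r polyC0 add0r mulr1 polyX_eq0.
  by split=> //; apply/sub_kermxP.
have em : m = n.+1.
  by apply/eqP; rewrite eqn_leq le_mn -(eqP fA) rank_leq_col.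
move: A B fA {le_mn}; rewrite em => A B; rewrite row_free_unit => uA.
have [b] : exists b, root (char_poly (B *m invmx A)) b.
  by apply/closed_rootP; rewrite size_char_poly.
rewrite -eigenvalue_root_char => /eigenvalueP[u uB u0].
exists u, (u *m A), 1, b; rewrite scale1r; split=> //.
  apply/eqP=> /(congr1 (fun p : {poly F} => p`_0)); rewrite coefD coefC coef0 coefXM /= addr0.
  by apply/eqP; rewrite oner_eq0.
by rewrite scalemxAl -uB mulmxA mulmxKV.
Qed.

Lemma pencil_spans_multiples n m k (A B : 'M[F]_(n, m)) : spans_multiples k A B.
Proof.
(* The sum n + m is unchanged by transposition and drops in both reductions; k is generalized
   because the block reduction lowers it. *)
have [N] := ubnP (n + m); elim: N => // N IH in k n m A B *; rewrite ltnS => leN.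
case: k => [|k]; first exact: spans_multiples0.
wlog le_mn : n m A B leN / (m <= n)%N.
  move=> H; have [/H|/ltnW le_nm] := leqP m n; first exact.
  by apply: spans_multiples_tr; apply: H => //; rewrite addnC.
case: n A B le_mn leN => [|n] A B le_mn leN; first exact: spans_multiples_flat.
have [u [w [a [b [u0 l0 uA uB]]]]] := pencil_kernel A B le_mn.
have [P uP Pu] := @row_completion _ n u u0.
have usubP Z z (v : 'rV_m) : u *m Z = z *: v -> usubmx (P *m Z : 'M_(1 + n, m)) = z *: v.
  by move=> <-; rewrite -Pu -mul_usub_mx.
have [w0|w0] := eqVneq w 0.
  apply: (@spans_multiples_mul _ _ _ _ _ _ _ _ (P *m A) (P *m B) P (invmx P) 1%:M 1%:M);
    rewrite ?mulmx1 ?mulKmx //.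
  rewrite -[P *m A](vsubmxK (P *m A : 'M_(1 + n, m))) (usubP _ _ _ uA).
  rewrite -[P *m B](vsubmxK (P *m B : 'M_(1 + n, m))) (usubP _ _ _ uB) w0 !scaler0.
  by apply: spans_multiples_col; apply: IH.
case: m A B w w0 leN le_mn uA uB usubP => [|m] A B w w0 leN le_mn uA uB usubP.
  by rewrite [w]thinmx0 eqxx in w0.
have [Q uQ wQ] := @row_normal_form _ m w; rewrite w0 in wQ.
apply: (@spans_multiples_mul _ _ _ _ _ _ _ _ (P *m A *m Q) (P *m B *m Q)
  P (invmx P) Q (invmx Q)) => //;
  rewrite ?mulmxA ?mulmxK ?mulVmx ?mul1mx //.
(* The first row of [P] is [u], so that of [P *m Z] is z w, and [Q] carries [w] to (1, 0, .., 0). *)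
have blockE Z z : u *m Z = z *: w -> exists c : 'cV_n, exists Z' : 'M_(n, m),
    P *m Z *m Q = block_mx z%:M 0 c Z' :> 'M_(1 + n, 1 + m).
  move=> uZ; set Y : 'M_(1 + n, 1 + m) := P *m Z *m Q.
  exists (dlsubmx Y), (drsubmx Y); rewrite -[LHS]submxK.
  have : usubmx Y = row_mx z%:M 0.
    rewrite /Y -mul_usub_mx (usubP _ _ _ uZ) -scalemxAl wQ scale_row_mx scaler0.
    by rewrite scale_scalar_mx mulr1.
  by rewrite -[usubmx Y]hsubmxK => /eq_row_mx[eul eur]; rewrite /ulsubmx /ursubmx eul eur.
have [c [A' eA]] := blockE _ _ uA; have [c' [B' eB]] := blockE _ _ uB.
have IHk : spans_multiples k A' B'.
  by apply: IH; move: leN; rewrite addSn addnS => /ltnW.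
by have := spans_multiples_block c c' l0 IHk; rewrite -eA -eB.
Qed.
End ClosedField.

(** * Homogeneous polynomials and binary forms *)

Section Homogeneous.
Variable F : fieldType.
Implicit Types (p q : {poly F}) (f g : {mpoly F[2]}).

(** Homogenization in degree [e], truncating [p] beyond that degree; hence the size bounds in the
    lemmas below. *)
Definition binary_form e p : {mpoly F[2]} :=
  \sum_(i < e.+1) p`_i *: ('X_0 ^+ (e - i) * 'X_1 ^+ i).

(** The index serves as exponent: X_0 goes to 1 and X_1 to X. *)
Definition dehomogenize f : {poly F} := mmap polyC (fun i : 'I_2 => 'X ^+ i) f.

Lemma binary_form_is_linear e : linear (binary_form e).
Proof.
move=> c p q; rewrite /binary_form scaler_sumr -big_split.
by apply: eq_bigr => i _; rewrite coefD coefZ scalerDl scalerA.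
Qed.

HB.instance Definition _ e :=
  GRing.isLinear.Build F {poly F} {mpoly F[2]} _ (binary_form e) (binary_form_is_linear e).

HB.instance Definition _ := GRing.RMorphism.copy dehomogenize
  (mmap polyC (fun i : 'I_2 => 'X ^+ i)).

Lemma dehomogenizeZ c f : dehomogenize (c *: f) = c *: dehomogenize f.
Proof. by rewrite /dehomogenize mmapZ mul_polyC. Qed.

Lemma dehomogenizeXU i : dehomogenize 'X_i = 'X ^+ i.
Proof. by rewrite /dehomogenize mmapX mmap1U. Qed.

Lemma binary_formXn e j : (j <= e)%N -> binary_form e 'X^j = 'X_0 ^+ (e - j) * 'X_1 ^+ j.
Proof.
move=> le_je; rewrite /binary_form (bigD1 (Ordinal (le_je : (j < e.+1)%N))) //= coefXn eqxx scale1r.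
rewrite big1 ?addr0 // => i /negPf ne_ij.
by rewrite coefXn -[j]/(val (Ordinal (le_je : (j < e.+1)%N))) val_eqE ne_ij scale0r.
Qed.

Lemma binary_form_homog e p : binary_form e p \is e.-homog.
Proof.
apply: rpred_sum => i _; apply: rpredZ.
have homX (v : 'I_2) j : ('X_v ^+ j : {mpoly F[2]}) \is j.-homog.
  have homXv : ('X_v : {mpoly F[2]}) \is 1.-homog by rewrite dhomogX; apply/eqP; exact: mdeg1.
  by have := dhomogMn j homXv; rewrite mul1n.
by have := dhomogM (homX 0 (e - i)%N) (homX 1 i); rewrite subnK // -ltnS.
Qed.

Lemma binary_formK e p : (size p <= e.+1)%N -> dehomogenize (binary_form e p) = p.
Proof.
move=> sp; rewrite /binary_form rmorph_sum /=.
transitivity (\sum_(i < e.+1) p`_i *: 'X^i).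
  apply: eq_bigr => i _; rewrite dehomogenizeZ rmorphM !rmorphXn /= !dehomogenizeXU.
  by rewrite expr0 expr1n mul1r expr1.
by rewrite -poly_def; apply/polyP=> i; rewrite coef_poly; case: ltnP => // /(leq_trans sp)
  /leq_sizeP ->.
Qed.

Lemma mpolyX2 (m : 'X_{1..2}) : 'X_[m] = 'X_0 ^+ m 0 * 'X_1 ^+ m 1 :> {mpoly F[2]}.
Proof.
rewrite mpolyXE_id big_ord_recl big_ord1; congr ('X__ ^+ m _ * 'X__ ^+ m _);
  exact/val_inj.
Qed.

Lemma homog_mdeg n e (f : {mpoly F[n]}) (m : 'X_{1..n}) :
  f \is e.-homog -> m \in msupp f -> mdeg m = e.
Proof. by move=> /dhomogP; apply. Qed.

Lemma dehomogenizeK e f : f \is e.-homog -> binary_form e (dehomogenize f) = f.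
Proof.
move=> /homog_mdeg homf; rewrite [in RHS](mpolyE f) {1}(mpolyE f) rmorph_sum linear_sum /=.
rewrite big_seq [RHS]big_seq; apply: eq_bigr => m /homf em.
rewrite dehomogenizeZ linearZ /= mpolyX2 rmorphM !rmorphXn /= !dehomogenizeXU.
have {}em : (m 0%R + m 1%R = e)%N.
  rewrite -em mdegE big_ord_recl big_ord1; congr (m _ + m _)%N; exact/val_inj.
by rewrite expr0 expr1n mul1r expr1 binary_formXn -em ?leq_addl // addnK.
Qed.

(** Both sides are homogeneous of degree e + e', so comparing their dehomogenizations is enough. *)
Lemma binary_formM e e' p q : (size p <= e.+1)%N -> (size q <= e'.+1)%N ->
  binary_form (e + e') (p * q) = binary_form e p * binary_form e' q.
Proof.
move=> sp sq; rewrite -[RHS](@dehomogenizeK (e + e')); last first.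
  by apply: dhomogM; apply: binary_form_homog.
by rewrite rmorphM /= !binary_formK.
Qed.

Lemma size_dehomogenize e f : f \is e.-homog -> (size (dehomogenize f) <= e.+1)%N.
Proof.
move=> /homog_mdeg homf; rewrite (mpolyE f) rmorph_sum big_seq /=.
apply: (leq_trans (size_sum _ _ _)); apply/bigmax_leqP_seq => m _ /homf em.
rewrite dehomogenizeZ (leq_trans (size_scale_leq _ _)) //.
rewrite mpolyX2 rmorphM !rmorphXn /= !dehomogenizeXU expr0 expr1n mul1r expr1 size_polyXn ltnS -em.
rewrite mdegE big_ord_recl big_ord1 (_ : lift _ _ = 1) ?leq_addl //; exact/val_inj.
Qed.

Lemma meval_binary_form e p (x : 'rV[F]_2) :
  (binary_form e p).@[x 0] = \sum_(i < e.+1) p`_i * (x 0 0 ^+ (e - i) * x 0 1 ^+ i).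
Proof.
rewrite /binary_form raddf_sum /=; apply: eq_bigr => i _.
by rewrite mevalZ mevalM !rmorphXn /= !mevalXU.
Qed.

Lemma meval_homogZ n e (f : {mpoly F[n]}) (c : F) (x : 'rV[F]_n) :
  f \is e.-homog -> f.@[(c *: x) 0] = c ^+ e * f.@[x 0].
Proof.
move=> /homog_mdeg homf; rewrite !mevalE mulr_sumr big_seq [RHS]big_seq.
apply: eq_bigr => m /homf <-; rewrite mdegE -prodrXr mulrCA -big_split /=; congr (_ * _).
by apply: eq_bigr => i _; rewrite mxE exprMn.
Qed.

(** Multiplication by [g] shifts the degree of each homogeneous component of [f] by e', so only the
    one of degree e contributes. *)
Lemma pihomogM n e e' (f g : {mpoly F[n]}) :
  g \is e'.-homog -> pihomog mdeg (e + e') (f * g) = pihomog mdeg e f * g.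
Proof.
move=> homg; have [N leN] : exists N, (maxn (mmeasure mdeg f) e.+1 <= N)%N by eexists.
move: leN; rewrite geq_max => /andP[leN ltN].
rewrite {1}(pihomog_partitionE leN) mulr_suml linear_sum /=.
rewrite (bigD1 (Ordinal ltN)) //= big1 ?addr0.
  by apply: pihomog_dE; apply: dhomogM => //; apply: pihomogP.
move=> i; rewrite -val_eqE /= => ne_ie.
have ne : (i + e')%N != (e + e')%N by rewrite eqn_add2r.
apply: (pihomog_ne0 ne).
by apply: dhomogM => //; apply: pihomogP.
Qed.
Lemma linear_combination_homog n (c : 'I_n -> F) :
  (\sum_a c a *: 'X_a : {mpoly F[n]}) \is 1.-homog.
Proof.
apply: rpred_sum => a _; apply: rpredZ.
by rewrite dhomogX; apply/eqP; exact: mdeg1.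
Qed.

Lemma meval_linear_combination n (c : 'I_n -> F) (y : 'rV[F]_n) :
  (\sum_a c a *: 'X_a).@[y 0] = (y *m \col_a c a) 0 0.
Proof.
rewrite raddf_sum /= mxE; apply: eq_bigr => a _.
by rewrite mevalZ mevalXU mxE mulrC.
Qed.

End Homogeneous.

(** * Products of matrices and minors *)

Section Minors.
Variables (R : comNzRingType).

Lemma det_mulmx_rows n k (P : 'M[R]_(k, n)) (X : 'M_(n, k)) :
  \det (P *m X) = \sum_(f : {ffun 'I_k -> 'I_n}) (\prod_i P i (f i)) * \det (rowsub f X).
Proof.
rewrite /determinant; under [RHS]eq_bigr do rewrite mulr_sumr.
rewrite exchange_big; apply: eq_bigr => s _ /=.
under eq_bigr do rewrite mxE.
rewrite bigA_distr_bigA mulr_sumr; apply: eq_bigr => f _.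
rewrite mulrCA; congr (_ * _); rewrite -big_split.
by apply: eq_bigr => i _; rewrite !mxE.
Qed.

(** A Cauchy-Binet formula over all maps instead of subsets, from multilinearity in the rows and
    then in the columns. *)
Lemma det_mulmx_mxsub n m k (P : 'M[R]_(k, n)) (M : 'M_(n, m)) (Q : 'M_(m, k)) :
  \det (P *m M *m Q) = \sum_(f : {ffun 'I_k -> 'I_n}) \sum_(g : {ffun 'I_k -> 'I_m})
    (\prod_i P i (f i) * \prod_i Q (g i) i) * \det (mxsub f g M).
Proof.
rewrite -mulmxA det_mulmx_rows; apply: eq_bigr => f _.
rewrite -mul_rowsub_mx -det_tr trmx_mul det_mulmx_rows mulr_sumr.
apply: eq_bigr => g _; rewrite mulrA; congr (_ * _ * _).
  by apply: eq_bigr => i _; rewrite mxE.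
by rewrite -det_tr; congr (\det _); apply/matrixP=> i j; rewrite !mxE.
Qed.

(** The subset is the sorted list of the values of [f], and [s] is the sorting permutation. *)
Lemma ksubset_perm n k (f : 'I_k -> 'I_n) : injective f ->
  exists (r : ksubset n k) (s : 'S_k), forall i, f i = tnth (val r) (s i).
Proof.
move=> f_inj; pose t := [tuple f i | i < k].
pose le (i j : 'I_n) := (i <= j)%N.
have st : sorted ltn [seq val i | i <- sort_tuple le t].
  rewrite ltn_sorted_uniq_leq sorted_map (map_inj_uniq val_inj) sort_uniq.
  rewrite map_inj_uniq ?enum_uniq //=; apply: sort_sorted => i j; exact: leq_total.
have /tuple_permP[s es] : perm_eq t (sort_tuple le t) by rewrite perm_sym perm_sort.
exists (exist _ (sort_tuple le t) st), s => i.
transitivity (tnth t i); first by rewrite tnth_mktuple.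
by rewrite [in LHS](val_inj es) tnth_mktuple.
Qed.

Lemma det_mxsub_perm n m k (M : 'M[R]_(n, m)) (f : 'I_k -> 'I_n) (g : 'I_k -> 'I_m)
    r c (s t : 'S_k) :
  (forall i, f i = r (s i)) -> (forall i, g i = c (t i)) ->
  \det (mxsub f g M) = (-1) ^+ s * (-1) ^+ t * \det (mxsub r c M).
Proof.
move=> fE gE; have -> : mxsub f g M = row_perm s (col_perm t (mxsub r c M)).
  by apply/matrixP=> i j; rewrite !mxE fE gE.
rewrite row_permE col_permE !det_mulmx !det_perm odd_permV.
by rewrite mulrCA mulrA [RHS]mulrC mulrA.
Qed.

Lemma det_mxsub_rows n m k (M : 'M[R]_(n, m)) (f : 'I_k -> 'I_n) (g : 'I_k -> 'I_m) :
  ~~ injectiveb f -> \det (mxsub f g M) = 0.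
Proof.
case/injectivePn => i [j ij fij]; apply: (determinant_alternate ij) => l.
by rewrite !mxE fij.
Qed.

Lemma det_mxsub_minor n m k (M : 'M[R]_(n, m)) (f : 'I_k -> 'I_n) (g : 'I_k -> 'I_m) :
  \det (mxsub f g M) = 0 \/
  exists (b : bool) (rc : minor_index n m k), \det (mxsub f g M) = (-1) ^+ b * minor M rc.
Proof.
have [/injectiveP f_inj|nf] := boolP (injectiveb f); last by left; apply: det_mxsub_rows.
have [/injectiveP g_inj|ng] := boolP (injectiveb g); last first.
  by left; rewrite -det_tr trmx_mxsub det_mxsub_rows.
have [r [s fE]] := ksubset_perm f_inj; have [c [t gE]] := ksubset_perm g_inj.
right; exists (odd_perm s (+) odd_perm t), (r, c).
by rewrite (det_mxsub_perm M fE gE) signr_addb.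
Qed.

End Minors.

(** * The pencil of slices of a tensor *)

Section TensorMinors.
Variables (F : fieldType) (n2 n3 k : nat) (T : tensor F 2 n2 n3).

Definition slice (i : 'I_2) : 'M[F]_(n2, n3) := \matrix_(j, l) T i j l.

Definition tensor_pencil := pencil (slice 0) (slice 1).

Definition pencil_minor (a : 'I_(nminors n2 n3 k)) : {poly F} :=
  minor tensor_pencil (enum_val a).

Lemma gen_minorE (P : 'M_(k, n2)) (Q : 'M_(n3, k)) :
  gen_minor (slice 0) (slice 1) P Q =
  \det (map_mx polyC P *m tensor_pencil *m map_mx polyC Q).
Proof.
by rewrite /gen_minor /tensor_pencil /pencil mulmxDr mulmxDl -scalemxAr -scalemxAl -!map_mxM.
Qed.

Lemma minor_span_pencil_minor a : minor_span k (slice 0) (slice 1) (pencil_minor a).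
Proof.
rewrite /pencil_minor; set rc := enum_val a.
have := @minor_span_gen _ _ _ k (slice 0) (slice 1)
  (rowsub (tnth (val rc.1)) 1%:M) (colsub (tnth (val rc.2)) 1%:M).
rewrite gen_minorE map_mxsub map_scalar_mx mul_rowsub_mx mul1mx.
by rewrite map_mxsub map_scalar_mx mulmx_colsub mulmx1 -mxsubcr.
Qed.

(** By Cauchy-Binet, each generator is a combination of determinants of submatrices, each zero or an
    ordinary minor up to sign. *)
Lemma minor_span_comb f : minor_span k (slice 0) (slice 1) f ->
  exists c : 'I_(nminors n2 n3 k) -> F, f = \sum_a c a *: pencil_minor a.
Proof.
pose W f := exists c : 'I_(nminors n2 n3 k) -> F, f = \sum_a c a *: pencil_minor a.
have W0 : W 0 by exists (fun=> 0); rewrite big1 // => a _; rewrite scale0r.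
have WP c u v : W u -> W v -> W (c *: u + v).
  move=> [x ->] [y ->]; exists (fun a => c * x a + y a).
  rewrite scaler_sumr -big_split; apply: eq_bigr => a _ /=.
  by rewrite scalerDl scalerA.
have WD u v : W u -> W v -> W (u + v) by rewrite -{2}[u]scale1r; apply: WP.
move/(_ W); apply=> // P Q; rewrite gen_minorE det_mulmx_mxsub.
apply: (big_ind W) => // g _; apply: (big_ind W) => // h _.
rewrite (eq_bigr (fun i => (P i (g i))%:P)) => [|i _]; last by rewrite mxE.
rewrite [X in _ * X * _](eq_bigr (fun i => (Q (h i) i)%:P)) => [|i _]; last by rewrite mxE.
rewrite -!rmorph_prod -rmorphM mul_polyC -[_ *: _]addr0; apply: WP => //.
have [->//|[b [rc ->]]] := det_mxsub_minor tensor_pencil g h.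
exists (fun a => (-1) ^+ b * (a == enum_rank rc)%:R).
rewrite (bigD1 (enum_rank rc)) //= big1 => [|a /negPf->]; last by rewrite mulr0 scale0r.
by rewrite eqxx mulr1 addr0 /pencil_minor enum_rankK;
  case: (b); rewrite ?expr0 ?expr1 ?scaleN1r ?scale1r ?mulN1r ?mul1r.
Qed.

Lemma prod_homog n j (G : 'I_j -> {mpoly F[n]}) :
  (forall i, G i \is 1.-homog) -> \prod_i G i \is j.-homog.
Proof.
elim: j G => [|j IH] G homG; first by rewrite big_ord0 dhomog1.
by rewrite big_ord_recl; apply: (@dhomogM _ _ _ 1); [apply: homG | apply: IH => i; apply: homG].
Qed.

Lemma tensor_minors_homog a : @tensor_minors _ _ _ _ T k a \is k.-homog.
Proof.
apply: rpred_sum => s _; rewrite rpredMsign; apply: prod_homog => i.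
rewrite !mxE; apply: rpred_sum => v _; apply: rpredZ.
by rewrite dhomogX; apply/eqP; exact: mdeg1.
Qed.

(** A form of degree k is recovered from its dehomogenization, and the matrix of linear forms
    dehomogenizes to the pencil of slices. *)
Lemma tensor_minorsE a : @tensor_minors _ _ _ _ T k a = binary_form k (pencil_minor a).
Proof.
rewrite -[LHS](dehomogenizeK (tensor_minors_homog a)); congr binary_form.
rewrite /tensor_minors /minor -det_map_mx map_mxsub; congr (\det (mxsub _ _ _)).
apply/matrixP=> j l; rewrite !mxE rmorph_sum big_ord_recl big_ord1 /=.
rewrite !dehomogenizeZ !dehomogenizeXU expr0 expr1 alg_polyC mulrC mul_polyC.
by congr ((T _ _ _)%:P + T _ _ _ *: _); exact/val_inj.
Qed.

End TensorMinors.

(** * Nonvanishing of polynomial functions *)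

Section Density.
Variable F : numFieldType.

(** In characteristic 0 the naturals below [size p] are distinct, which is one root too many. *)
Lemma poly_vanish (p : {poly F}) : (forall x, p.[x] = 0) -> p = 0.
Proof.
move=> p0; apply/eqP; apply: contraT => nz.
have := @max_poly_roots _ p [seq i%:R | i <- iota 0 (size p)] nz.
rewrite size_map size_iota ltnn; apply.
  by apply/allP => x _; apply/eqP.
by rewrite map_inj_uniq ?iota_uniq //; apply: mulrIn; apply: oner_neq0.
Qed.

Lemma poly_nonroot (p : {poly F}) : p != 0 -> exists x, p.[x] != 0.
Proof.
move=> p0; have [//|H] := EM (exists x, p.[x] != 0).
case/eqP: p0; apply: poly_vanish => x; apply/eqP/negPn/negP => px.
by apply: H; exists x.
Qed.

Definition restrict_line n (x z : 'rV[F]_n) (f : {mpoly F[n]}) : {poly F} :=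
  mmap polyC (fun i => (x 0 i)%:P + 'X * (z 0 i)%:P) f.

Lemma horner_restrict_line n (x z : 'rV[F]_n) f t :
  (restrict_line x z f).[t] = f.@[(x + t *: z) 0].
Proof.
rewrite /restrict_line /mmap horner_sum mevalE; apply: eq_bigr => m _.
rewrite hornerM hornerC horner_prod; congr (_ * _); apply: eq_bigr => i _.
by rewrite horner_exp !hornerE !mxE.
Qed.

(** On the line from [x] (t = 0) to [z] (t = 1) the product of [h] and [g] vanishes identically
    while [g] does not, so [h] restricts to 0. *)
Lemma meval_dense n (g h : {mpoly F[n]}) (z x : 'rV[F]_n) :
  g.@[z 0] != 0 -> (forall y : 'rV_n, g.@[y 0] != 0 -> h.@[y 0] = 0) -> h.@[x 0] = 0.
Proof.
move=> gz gh; have H : restrict_line x (z - x) h * restrict_line x (z - x) g = 0.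
  apply: poly_vanish => t; rewrite hornerM !horner_restrict_line.
  by have [->|/gh->] := eqVneq (g.@[(x + t *: (z - x)) 0]) 0; rewrite ?mulr0 ?mul0r.
move/eqP: H; rewrite mulf_eq0 => /orP[]/eqP H.
  by have := horner_restrict_line x (z - x) h 0; rewrite H horner0 scale0r addr0.
have := horner_restrict_line x (z - x) g 1; rewrite H horner0 scale1r addrC subrK.
by move/esym/eqP; rewrite (negPf gz).
Qed.

Lemma binary_form_nonroot e (p : {poly F}) : p != 0 -> (size p <= e.+1)%N ->
  exists2 z : 'rV[F]_2, z 0 0 != 0 & (binary_form e p).@[z 0] != 0.
Proof.
move=> /poly_nonroot[t pt] sp; exists (\row_i t ^+ i); first by rewrite mxE expr0 oner_eq0.
rewrite meval_binary_form (_ : \sum_(i < _) _ = p.[t]) //.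
rewrite (horner_coef_wide _ sp); apply: eq_bigr => i _.
by rewrite !mxE expr0 expr1n mul1r expr1.
Qed.

End Density.

(** * The degree of the base locus *)

Section HilbertFunction.
Variables (F : fieldType) (n2 n3 k : nat) (T : tensor F 2 n2 n3).
Variables (D : {poly F}) (d : nat).
Hypotheses (D0 : D != 0) (sD : (size D <= d.+1)%N) (le_dk : (d <= k)%N).
Hypothesis spanE :
  forall f, minor_span k (slice T 0) (slice T 1) f <-> multiples_of_form k D d f.

Let size_DM e (q : {poly F}) : (d <= e)%N -> (size q <= (e - d).+1)%N ->
  (size (D * q)%R <= e.+1)%N.
Proof.
move=> le_de sq; rewrite (leq_trans (size_polyMleq _ _)) //.
by move: (leq_add sD sq); rewrite addSn addnS subnKC //; case: (_ + _)%N.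
Qed.

(** The minors span D S_(k-d), and S_(e-k) S_(k-d) = S_(e-d); from degree k on, the ideal is thus
    that of D. *)
Lemma base_locus_idealP e f : (k <= e)%N -> f \is e.-homog ->
  base_locus_ideal T k f <->
  exists2 r : {poly F}, (size r <= (e - d).+1)%N & f = binary_form e (D * r).
Proof.
move=> le_ke homf; split=> [[h fE]|[r sr ->]].
  (* The minors have degree k, so only the components of degree e - k of the coefficients matter. *)
  pose h' a := dehomogenize (pihomog mdeg (e - k) (h a)).
  pose q (a : 'I_(nminors n2 n3 k)) : {poly F} := pencil_minor T a %/ D.
  have qP a : (size (q a) <= (k - d).+1)%N /\ pencil_minor T a = D * q a.
    have /spanE[r sr rE] := minor_span_pencil_minor (T := T) a.
    by rewrite /q rE mulKp.
  exists (\sum_a h' a * q a).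
    apply: (leq_trans (size_sum _ _ _)); apply/bigmax_leqP => a _.
    rewrite (leq_trans (size_polyMleq _ _)) //.
    have := leq_add (size_dehomogenize (pihomogP mdeg (e - k) (h a))) (qP a).1.
    by rewrite addSn addnS addnBA // subnK // -/(h' a); case: (_ + _)%N.
  rewrite -(pihomog_dE homf) -{1}(subnK le_ke) fE linear_sum mulr_sumr linear_sum /=.
  apply: eq_bigr => a _; rewrite pihomogM ?tensor_minors_homog //.
  rewrite tensor_minorsE mulrCA -(qP a).2 -[in RHS](subnK le_ke) binary_formM.
  - by rewrite dehomogenizeK ?pihomogP.
  - exact: size_dehomogenize (pihomogP _ _ _).
  - by rewrite (qP a).2 size_DM // (qP a).1.
pose I := base_locus_ideal T k.
have I0 : I 0 by exists (fun=> 0); rewrite big1 // => a _; rewrite mul0r.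
have ID u v : I u -> I v -> I (u + v).
  move=> [x ->] [y ->]; exists (fun a => x a + y a).
  by rewrite -big_split; apply: eq_bigr => a _; rewrite mulrDl.
have IM u v : I v -> I (u * v).
  move=> [x ->]; exists (fun a => u * x a).
  by rewrite mulr_sumr; apply: eq_bigr => a _; rewrite mulrA.
rewrite -[r]coefK poly_def mulr_sumr linear_sum; apply: (big_ind I) => // i _ /=.
rewrite -scalerAr linearZ /= -mul_mpolyC; apply: (IM).
(* The exponent is split so that D X^i1 lies in the span of the minors and X^i2 is a multiplier of
   degree at most e - k. *)
have [i1 [i2 [le_i1 le_i2 iE]]] : exists i1 i2,
    [/\ (i1 <= k - d)%N, (i2 <= e - k)%N & i = i2 + i1 :> nat]%N.
  exists (minn i (k - d)), (i - minn i (k - d))%N.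
  have : (i <= e - d)%N by rewrite -ltnS (leq_trans (ltn_ord i)).
  rewrite geq_minr subnK ?geq_minl // /minn; case: ltnP => [_|le_i] le_ie; split=> //.
    by rewrite subnn.
  by rewrite leq_subLR addnBAC // subnKC // (leq_trans le_dk).
rewrite iE exprD mulrCA -{1}(subnK le_ke) binary_formM ?size_polyXn //; last first.
  by rewrite size_DM // size_polyXn.
apply: IM; have /minor_span_comb[c ->] : minor_span k (slice T 0) (slice T 1) (D * 'X^i1).
  by apply/spanE; exists 'X^i1; rewrite ?size_polyXn.
exists (fun a => (c a)%:MP); rewrite linear_sum; apply: eq_bigr => a _ /=.
by rewrite linearZ /= tensor_minorsE mul_mpolyC.
Qed.

(** Multiplication by D maps S_(e-d) isomorphically onto the degree e piece of the ideal, leaving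
    dimension (e + 1) - (e - d + 1) = d. *)
Lemma hilbert_function_base_locus e h : (k <= e)%N ->
  hilbert_function (base_locus_ideal T k) e h -> h = d.
Proof.
move=> le_ke [U UE ->]; have le_de := leq_trans le_dk le_ke.
pose phi (v : 'rV[F]_(e - d).+1) : dhomog 2 F e :=
  DHomog (binary_form_homog e (D * rVpoly v)).
have phi_lin : linear phi.
  move=> c u v; apply: val_inj => /=.
  by rewrite linearP mulrDr -scalerAr linearP.
pose phiL : {linear 'rV[F]_(e - d).+1 -> dhomog 2 F e} :=
  HB.pack phi (GRing.isLinear.Build _ _ _ _ phi phi_lin).
have UE' : U = limg (linfun phiL).
  apply/vspaceP => f; apply/idP/idP => [/UE|/memv_imgP[v _ ->]].
    move/(base_locus_idealP le_ke (dhomog_is_dhomog f)) => [r sr fE].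
    apply/memv_imgP; exists (poly_rV r); first exact: memvf.
    by rewrite lfunE; apply: val_inj; rewrite /= poly_rV_K.
  apply/UE/(base_locus_idealP le_ke (dhomog_is_dhomog _)).
  by exists (rVpoly v); rewrite ?size_poly // lfunE.
have ker0 : (lker (linfun phiL) == 0)%VS.
  apply/lker0P => u v; rewrite !lfunE => /(congr1 val)/(congr1 (@dehomogenize F)) /=.
  rewrite !binary_formK ?size_DM ?size_poly // => /(mulfI D0).
  by move/(congr1 (@poly_rV F (e - d).+1)); rewrite !rVpolyK.
rewrite UE' limg_dim_eq; last by rewrite (eqP ker0) capv0.
rewrite !dimvf /dim /= mul1n addn1 binSn subSS subKn //.
Qed.

End HilbertFunction.

(** * Projective geometry *)

Section ProjectiveLine.
Variable F : numFieldType.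
Local Open Scope classical_set_scope.

Lemma sub_zariski_closure n (X : set 'rV[F]_n) :
  (forall x, X x -> x <> 0) -> X `<=` zariski_closure X.
Proof. by move=> X0 x Xx; split; [apply: X0 | move=> f [_]; apply]. Qed.

Lemma zariski_closedZ n (Z : set 'rV[F]_n) c x :
  zariski_closed Z -> c != 0 -> Z x -> Z (c *: x).
Proof.
move=> <- c0 [x0 Zx]; split; first by move/eqP; rewrite scaler_eq0 (negPf c0) => /eqP.
move=> f [[e homf] fZ]; rewrite (meval_homogZ _ _ homf) Zx ?mulr0 //.
by split=> //; exists e.
Qed.

Lemma zariski_closed_nonzero n : zariski_closed [set y : 'rV[F]_n | y <> 0].
Proof.
apply/seteqP; split=> [y []//|]; exact: sub_zariski_closure.
Qed.

(** If A misses a point z, some f vanishes on A but not at z; every g vanishing on B then vanishes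
    where f does not, hence everywhere by density. *)
Lemma irreducible_closed_nonzero n : irreducible_closed [set y : 'rV[F]_n.+1 | y <> 0].
Proof.
split; first exact: zariski_closed_nonzero.
  exists (const_mx 1) => /eqP; apply/negP.
  by apply/eqP=> /rowP/(_ 0); rewrite !mxE; apply/eqP; apply: oner_neq0.
move=> A B cA cB sub; have [?|nA] := EM ([set y : 'rV[F]_n.+1 | y <> 0] `<=` A); first by left.
right=> x /= x0; rewrite -cB; split=> // g [_ gB].
have [z [z0 nAz]] : exists z : 'rV[F]_n.+1, z <> 0 /\ ~ A z.
  have [//|H] := EM (exists z : 'rV[F]_n.+1, z <> 0 /\ ~ A z); case: nA => z z0.
  by have [//|nAz] := EM (A z); case: H; exists z.
have [f [fA fz]] : exists f : {mpoly F[n.+1]},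
    (forall y, A y -> f.@[y 0] = 0) /\ f.@[z 0] != 0.
  have [//|H] := EM (exists f : {mpoly F[n.+1]},
    (forall y, A y -> f.@[y 0] = 0) /\ f.@[z 0] != 0).
  case: nAz; rewrite -cA; split=> // f [_ fA]; apply/eqP/negPn/negP => fz.
  by apply: H; exists f.
have [i zi] : exists i, z 0 i != 0.
  have [//|H] := EM (exists i, z 0 i != 0); case: z0; apply/rowP => i; rewrite mxE.
  by apply/eqP/negPn/negP => zi; apply: H; exists i.
(* The factor ['X_i] keeps the test vectors away from 0, which represents no point. *)
apply: (@meval_dense _ _ (f * 'X_i) g z); first by rewrite mevalM mevalXU mulf_neq0.
move=> y; rewrite mevalM mevalXU mulf_eq0 negb_or => /andP[fy yi].
have y0 : y <> 0 by move=> y0; move: yi; rewrite y0 mxE eqxx.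
by case: (sub y y0) => [/fA|/gB//] e; rewrite e eqxx in fy.
Qed.

Lemma irreducible_closed_delta :
  irreducible_closed [set y : 'rV[F]_2 | exists2 c, c <> 0 & y = c *: delta_mx 0 0].
Proof.
set Z := [set y | _].
have d0 : delta_mx 0 0 <> 0 :> 'rV[F]_2.
  by move/rowP/(_ 0); rewrite !mxE /=; apply/eqP; apply: oner_neq0.
have Z0 y : Z y -> y <> 0.
  by move=> [c /eqP c0 ->] /eqP; rewrite scaler_eq0 (negPf c0) => /eqP.
split.
- apply/seteqP; split; last exact: sub_zariski_closure.
  move=> y [y0 Hy]; have y1 : y 0 1 = 0.
    have := Hy 'X_1; rewrite mevalXU; apply; split.
      by exists 1%N; rewrite dhomogX; apply/eqP; exact: mdeg1.
    by move=> _ [c _ ->]; rewrite mevalXU !mxE mulr0.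
  have yE : y = y 0 0 *: delta_mx 0 0.
    apply/rowP => i; rewrite !mxE /=; case: i => -[|[|//]] ilt.
      by rewrite (_ : Ordinal ilt = 0) ?mulr1 //; exact/val_inj.
    by rewrite (_ : Ordinal ilt = 1) ?mulr0 //; exact/val_inj.
  by exists (y 0 0) => // e; apply: y0; rewrite yE e scale0r.
- by exists (delta_mx 0 0), 1; rewrite ?scale1r //; apply/eqP; apply: oner_neq0.
move=> A B cA cB sub; have : (A `|` B) (delta_mx 0 0).
  by apply: sub; exists 1; rewrite ?scale1r //; apply/eqP; apply: oner_neq0.
by case=> Hd; [left | right] => _ [c /eqP c0 ->]; apply: zariski_closedZ.
Qed.

(** The point [1 : 0] is strictly contained in the irreducible line, which also contains [0 : 1]. *)
Lemma projective_line_not_dim_le0 : ~ dim_le0 [set y : 'rV[F]_2 | y <> 0].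
Proof.
move=> H; have sub : [set y : 'rV[F]_2 | exists2 c, c <> 0 & y = c *: delta_mx 0 0]
    `<=` [set y | y <> 0].
  move=> _ [c /eqP c0 ->] /eqP; rewrite scaler_eq0 (negPf c0) => /eqP/rowP/(_ 0).
  by rewrite !mxE /=; apply/eqP; apply: oner_neq0.
have E := H _ _ irreducible_closed_delta (irreducible_closed_nonzero _) sub (fun=> id).
have : [set y : 'rV[F]_2 | y <> 0] (delta_mx 0 1).
  by move/rowP/(_ 1); rewrite !mxE /=; apply/eqP; apply: oner_neq0.
rewrite -E => -[c _ /rowP/(_ 1)]; rewrite !mxE /= mulr0.
by apply/eqP; apply: oner_neq0.
Qed.

End ProjectiveLine.

(** * Equations of the rational normal curve *)

Section Veronese.
Variable F : fieldType.

Lemma veronese_neq0 m (x : 'rV[F]_2) : x <> 0 -> veronese m x <> 0.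
Proof.
move=> x0 v0; apply: x0; apply/rowP => i; rewrite mxE.
have e0 : x 0 0 = 0.
  have /rowP/(_ ord0) := v0; rewrite !mxE /= subn0 expr0 mulr1 => /eqP.
  by rewrite expf_eq0 => /andP[_ /eqP].
have e1 : x 0 1 = 0.
  have /rowP/(_ ord_max) := v0; rewrite !mxE /= subnn expr0 mul1r => /eqP.
  by rewrite expf_eq0 => /andP[_ /eqP].
case: i => -[|[|//]] ilt; [rewrite -[RHS]e0 | rewrite -[RHS]e1];
  congr (x _ _); exact/val_inj.
Qed.

(** The relations are the 2 x 2 minors of the matrix with rows (z_0, .., z_(m-1)) and (z_1, ..,
    z_m). If z_0 = 0 they kill all coordinates but the last, which is the image of [0 : 1];
    otherwise z is a geometric progression, the image of [1 : l]. *)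
Lemma veroneseP m (z : 'rV[F]_m.+1) : z <> 0 ->
  (forall i j : nat, (i < m)%N -> (j < m)%N ->
    z 0 (inord i) * z 0 (inord j.+1) = z 0 (inord i.+1) * z 0 (inord j)) ->
  exists x c, [/\ x <> 0, c <> 0 & z = c *: veronese m x].
Proof.
move=> z0 H; have [e0|n0] := eqVneq (z 0 0) 0.
  have zlt i : (i < m)%N -> z 0 (inord i) = 0.
    elim: i => [|i IH] lt_im.
      by rewrite (_ : inord 0 = 0) //; apply: val_inj; rewrite /= inordK.
    have := H i i.+1 (ltnW lt_im) lt_im.
    by rewrite IH 1?ltnW // mul0r => /esym/eqP; rewrite mulf_eq0 orbb => /eqP.
  have zE (i : 'I_m.+1) : z 0 i = z 0 ord_max * 0 ^+ (m - i).
    have [lt_im|] := ltnP i m; last first.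
      rewrite leq_eqVlt ltnNge -ltnS ltn_ord orbF => /eqP ei.
      rewrite -ei subnn mulr1; congr (z _ _); exact/val_inj.
    by rewrite -[i in LHS]inord_val zlt // expr0n subn_eq0 leqNgt lt_im mulr0.
  exists (delta_mx 0 1), (z 0 ord_max); split.
  - by move/rowP/(_ 1); rewrite !mxE /=; apply/eqP; apply: oner_neq0.
  - by move=> zm; apply: z0; apply/rowP => i; rewrite zE zm mul0r mxE.
  - by apply/rowP => i; rewrite zE !mxE /= expr1n mulr1.
(* For m = 0, [inord 1] defaults to 0 and [l] is 1, which is harmless as only l^0 occurs. *)
pose l := z 0 (inord 1) / z 0 0.
have zE (i : nat) : (i <= m)%N -> z 0 (inord i) = z 0 0 * l ^+ i.
  elim: i => [|i IH] lt_im.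
    by rewrite expr0 mulr1; congr (z _ _); apply: val_inj; rewrite /= inordK.
  have := H 0%N i (leq_ltn_trans (leq0n _) lt_im) lt_im.
  rewrite (_ : inord 0 = 0); last by apply: val_inj; rewrite /= inordK.
  have lE : z 0 (inord 1) = l * z 0 0 by rewrite divfK.
  rewrite IH 1?ltnW // => e; apply: (mulfI n0); rewrite e lE exprS.
  by rewrite [l * _]mulrC -mulrA [l * _]mulrCA.
exists (\row_i l ^+ i), (z 0 0); split.
- by move/rowP/(_ 0); rewrite !mxE expr0; apply/eqP; apply: oner_neq0.
- exact/eqP.
- apply/rowP => i; rewrite !mxE expr0 expr1n mul1r expr1 -zE ?inord_val //.
  by rewrite -ltnS.
Qed.

End Veronese.

(** * The collineation variety *)

Section Variety.
Variables (F : numFieldType) (n2 n3 k : nat) (T : tensor F 2 n2 n3).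
Variables (D : {poly F}) (d : nat).
Hypotheses (D0 : D != 0) (sD : (size D <= d.+1)%N) (le_dk : (d <= k)%N).
Hypothesis spanE :
  forall f, minor_span k (slice T 0) (slice T 1) f <-> multiples_of_form k D d f.
Local Open Scope classical_set_scope.

(** The linear map that follows the Veronese map: each column holds the coefficients of a minor
    divided by D. *)
Definition quotient_mx : 'M[F]_((k - d).+1, nminors n2 n3 k) :=
  \matrix_(i, a) (pencil_minor T a %/ D)`_i.

Let pencil_minorE (a : 'I_(nminors n2 n3 k)) :
  (size (pencil_minor T a %/ D)%R <= (k - d).+1)%N /\
  pencil_minor T a = D * (pencil_minor T a %/ D).
Proof.
have /spanE[r sr rE] := minor_span_pencil_minor (T := T) a.
by rewrite rE mulKp.
Qed.

Lemma collineation_mapE x :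
  collineation_map T k x =
    (binary_form d D).@[x 0] *: (veronese (k - d) x *m quotient_mx).
Proof.
apply/rowP => a; rewrite !mxE tensor_minorsE (pencil_minorE a).2.
rewrite -{1}(subnKC le_dk) binary_formM ?(pencil_minorE a).1 // mevalM.
congr (_ * _); rewrite meval_binary_form.
by apply: eq_bigr => i _; rewrite !mxE mulrC.
Qed.

(** Each D X^j is a combination of minors; after cancelling D, the coefficients form a right
    inverse. *)
Lemma quotient_mx_free : row_free quotient_mx.
Proof.
have [c cE] : exists c : 'I_(k - d).+1 -> 'I_(nminors n2 n3 k) -> F,
    forall j : 'I_(k - d).+1, D * 'X^j = \sum_a c j a *: pencil_minor T a.
  apply: (@fin_all_exists _ _ (fun (j : 'I_(k - d).+1) (c : 'I_(nminors n2 n3 k) -> F) =>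
    D * 'X^j = \sum_a c a *: pencil_minor T a)) => j.
  by apply: minor_span_comb; apply/spanE; exists 'X^j; rewrite ?size_polyXn.
apply/row_freeP; exists (\matrix_(a, j) c j a); apply/matrixP => i j.
have {cE} : 'X^j = \sum_a c j a *: (pencil_minor T a %/ D).
  apply: (mulfI D0); rewrite cE mulr_sumr; apply: eq_bigr => a _.
  by rewrite -scalerAr -(pencil_minorE a).2.
move/(congr1 (fun p : {poly F} => p`_i)); rewrite coefXn coef_sum !mxE => ->.
by apply: eq_bigr => a _; rewrite !mxE coefZ mulrC.
Qed.

Lemma collineation_varietyE :
  collineation_variety T k = [set y | exists x : 'rV[F]_2, exists c : F,
    [/\ x <> 0, c <> 0 & y = c *: (veronese (k - d) x *m quotient_mx)]].
Proof.
apply/seteqP; split=> [y [y0 yP]|_ [x [c [x0 /eqP c0 ->]]]]; last first.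
  split.
    move/eqP; rewrite scaler_eq0 (negPf c0) /= => /eqP.
    move/eqP; rewrite mulmx_free_eq0 ?quotient_mx_free // => /eqP.
    exact: veronese_neq0.
  move=> f [[e homf] fX]; rewrite (meval_homogZ _ _ homf).
  (* [h] is [f] pulled back to the line. It vanishes where D and X_0 are nonzero, hence everywhere
     by density, in particular at the zeros of D. *)
  pose h : {mpoly F[2]} := f \mPo
    [tuple binary_form (k - d) (pencil_minor T a %/ D) | a < nminors n2 n3 k].
  have hE (y : 'rV[F]_2) : h.@[y 0] = f.@[(veronese (k - d) y *m quotient_mx) 0].
    rewrite comp_mpoly_meval; apply: meval_eq => a.
    rewrite tnth_mktuple meval_binary_form mxE; apply: eq_bigr => i _.
    by rewrite !mxE mulrC.
  rewrite -hE; have [z z0 Dz] := binary_form_nonroot D0 sD.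
  rewrite (@meval_dense _ _ (binary_form d D * 'X_0) h z) ?mulr0 //.
    by rewrite mevalM mevalXU mulf_neq0.
  move=> y; rewrite mevalM mevalXU mulf_eq0 negb_or => /andP[Dy y0].
  have : f.@[(collineation_map T k y) 0] = 0.
    apply: fX; split; last by exists y.
    rewrite collineation_mapE; apply/eqP; rewrite scaler_eq0 negb_or Dy /=.
    rewrite mulmx_free_eq0 ?quotient_mx_free //; apply/eqP; apply: veronese_neq0.
    by move=> e0; rewrite e0 mxE eqxx in y0.
  rewrite collineation_mapE (meval_homogZ _ _ homf) hE => /eqP.
  by rewrite mulf_eq0 expf_eq0 (negPf Dy) andbF => /eqP.
(* The columns of the cokernel give linear forms that vanish on the image, hence on its closure. *)
have yM : (y <= quotient_mx)%MS.
  rewrite submxE; apply/eqP/rowP => j; rewrite [RHS]mxE.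
  have := yP (\sum_a cokermx quotient_mx a j *: 'X_a).
  rewrite meval_linear_combination (_ : \col_a _ = col j (cokermx quotient_mx)); last first.
    by apply/colP => a; rewrite !mxE.
  rewrite colE mulmxA -colE mxE; apply; split.
    by exists 1%N; apply: linear_combination_homog.
  move=> _ [_ [x ->]]; rewrite meval_linear_combination.
  rewrite (_ : \col_a _ = col j (cokermx quotient_mx)); last first.
    by apply/colP => a; rewrite !mxE.
  rewrite collineation_mapE colE mulmxA -scalemxAl -(mulmxA _ quotient_mx) mulmx_coker.
  by rewrite mulmx0 scaler0 mul0mx mxE.
pose z := y *m pinvmx quotient_mx.
have yE : y = z *m quotient_mx by rewrite mulmxKpV.
(* These linear forms read off the coordinates [z], turning the quadrics of the rational normal
   curve into equations satisfied on the closure. *)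
pose L (i : 'I_(k - d).+1) : {mpoly F[nminors n2 n3 k]} :=
  \sum_a pinvmx quotient_mx a i *: 'X_a.
have LE i (v : 'rV_(nminors n2 n3 k)) : (L i).@[v 0] = (v *m pinvmx quotient_mx) 0 i.
  rewrite meval_linear_combination !mxE; apply: eq_bigr => a _.
  by rewrite !mxE.
have z0 : z <> 0 by move=> z0; apply: y0; rewrite yE z0 mul0mx.
have [|x [c [x0 c0 zE]]] := veroneseP z0.
  move=> i j lt_i lt_j; apply/eqP; rewrite -subr_eq0 -!LE -!mevalM -mevalB; apply/eqP.
  apply: yP; split.
    by exists 2%N; rewrite rpredB //; apply: (@dhomogM _ _ _ 1 _ 1);
      apply: linear_combination_homog.
  move=> _ [_ [x ->]]; rewrite mevalB !mevalM !LE collineation_mapE -!scalemxAl.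
  rewrite mulmxKp ?quotient_mx_free // !mxE.
  rewrite !inordK ?ltnS // 1?ltnW //.
  rewrite -(subnSK lt_i) -(subnSK lt_j) !exprS; ring.
by exists x, c; split=> //; rewrite yE zE scalemxAl.
Qed.

End Variety.

Theorem theorem3p1 (R : realType) (n2 n3 k p : nat) (T : tensor R[i] 2 n2 n3)
  (le_n23 : (n2 <= n3)%N)
  (T_concise : concise T)
  (k_bounds : (1 <= k <= n2)%N)
  (k_lt : n2 = n3 -> (k < n2)%N)
  (base_dim : dim_le0 (zero_locus (base_locus_ideal T k)))
  (base_deg : proj_degree (base_locus_ideal T k) p) :
  ((p < k)%N -> is_rational_normal_curve (k - p) (collineation_variety T k)) /\
  (p = k -> is_projective_point (collineation_variety T k)).
Proof.
have [span0|[D [d [D0 sD le_dk spanE]]]] :=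
  pencil_spans_multiples k (slice T 0) (slice T 1).
  (* If all minors vanished, the base locus would be the whole projective line. *)
  case: (@projective_line_not_dim_le0 R[i]).
  rewrite (_ : [set y | _]%classic = zero_locus (base_locus_ideal T k)) //.
  apply/seteqP; split=> [x x0|x []//]; split=> // _ [h ->].
  rewrite raddf_sum big1 // => a _ /=.
  rewrite tensor_minorsE (span0 _ (minor_span_pencil_minor a)) linear0 mulr0.
  exact: meval0.
have {base_deg} -> : p = d.
  case: base_deg => P [e0 HP] lcP.
  (* The difference P - d vanishes at all large integers, more than its degree allows. *)
  have PE : P = (d%:R : rat)%:P.
    apply/eqP; rewrite -subr_eq0; apply: contraT => nz.
    have := max_poly_roots (rs := [seq (e%:R : rat) |
      e <- iota (maxn e0 k) (size (P - d%:R%:P))]) nz.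
    rewrite size_map size_iota ltnn; apply; last first.
      by rewrite map_inj_uniq ?iota_uniq //; apply: mulrIn; apply: oner_neq0.
    apply/allP => _ /mapP[e + ->]; rewrite mem_iota geq_max => /andP[/andP[le_e0 le_ke] _].
    have [h Hh Ph] := HP e le_e0.
    rewrite rootE hornerD hornerN hornerC Ph.
    by rewrite (hilbert_function_base_locus D0 sD le_dk spanE le_ke Hh) subrr.
  move: lcP; rewrite PE lead_coefC size_polyC.
  (* The size of a constant is 0 or 1, so the factorial is 0! even when d = 0. *)
  have -> : ((d%:R : rat) != 0).-1`! = 1%N by case: (_ == _).
  by rewrite mulr1 => /eqP; rewrite eqr_nat => /eqP.
have VE := collineation_varietyE D0 sD le_dk spanE.
have fM := quotient_mx_free D0 spanE.
split=> [_|dk]; first by exists (quotient_mx k T D d).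
move: (quotient_mx k T D d) fM VE; rewrite dk subnn => M fM ->.
(* With p = k the Veronese map has degree 0 and is constantly (1), so the single row of [M] is the
   point. *)
have verE x : veronese 0 x *m M = M :> 'rV[R[i]]__.
  rewrite [veronese 0 x]mx11_scalar !mxE subn0 !expr0 mulr1.
  exact: mul1mx.
exists M; first by move=> M0; rewrite M0 /row_free mxrank0 in fM.
apply/seteqP; split=> [_ [x [c [x0 c0 ->]]]|_ [c c0 ->]]; first by exists c; rewrite ?verE.
exists (const_mx 1), c; split; rewrite ?verE //.
by move/rowP/(_ 0); rewrite !mxE; apply/eqP; apply: oner_neq0.
Qed.
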